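(* Let $g\colon Z_1\to Z_2$ be a Lipschitz map of compact metric spaces and let $n\ge1$. The induced radial function $f\colon \mathrm{Cone}(Z_1)\to \mathrm{Cone}(Z_2)$ between the corresponding hyperbolic cones is coarsely $n$-to-1 if there is $A>0$ such that for every $r>0$ and every sequence of $n+1$ points $x_1,\ldots,x_{n+1}$ in $Z_1$ satisfying $d(x_i,x_j)>r$ for $i\ne j$ there are two different indices $k,m\le n+1$ for which $d(g(x_k),g(x_m))\ge A\cdot r$.
   Context: The hyperbolic cone $\mathrm{Cone}(Z)$ over a bounded metric space $Z$ is the quotient of $Z\times[0,\infty)$ obtained by collapsing $Z\times\{0\}$ to a point $a$ (the base point), with the following metric. Put $\mu=\pi/\mathrm{diam}(Z)$ if $\mathrm{diam}(Z)>0$ and $\mu=1$ otherwise. For $x=(z,t)$ and $x'=(z',t')$, the distance $d(x,x')$ is the length of the third side of a (possibly degenerate) triangle in the hyperbolic plane $\mathbb H^2$ having two sides of lengths $t,t'$ with angle $\mu\, d(z,z')$ between them. $\mathrm{Cone}(Z)$ is a Gromov hyperbolic space, and for compact $Z$ its Gromov boundary is identified with $Z$, the point $z\in Z$ corresponding to the geodesic ray $t\mapsto(z,t)$ from $a$. The radial function induced by $g$ (with parameter $1$) maps the ray over $z$ to the ray over $g(z)$ preserving the distance to the base point: $f(z,t)=(g(z),t)$. A coarse function $f\colon X\to Y$ is coarsely $n$-to-1 if for every $R$ there is $S$ such that for each $B\subset Y$ with $\mathrm{diam}(B)<R$ one can write $f^{-1}(B)=B_1\cup\dots\cup B_n$ with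 $\mathrm{diam}(B_i)<S$ for all $i$. (Coarse: for every $R$ there is $S$ such that $d(x,y)<R$ implies $d(f(x),f(y))<S$, and preimages of bounded sets are bounded.) *)

(* Defs.v *)
From HB Require Import structures.
From mathcomp Require Import all_boot all_order all_algebra generic_quotient.
From mathcomp Require Import all_classical all_reals all_analysis.
From mathcomp Require Import ring lra.

Set Implicit Arguments.
Unset Strict Implicit.
Unset Printing Implicit Defensive.

Import Order.TTheory GRing.Theory Num.Theory.

Local Open Scope classical_set_scope.
Local Open Scope ring_scope.
Local Open Scope quotient_scope.

(* In \bar R; -oo on the empty set, +oo exactly on unbounded sets. *)
Definition diam (R : realType) (X : Type) (d : X -> X -> R) (B : set X) :
    \bar R :=
  ereal_sup [set (d x y)%:E | x in B & y in B].

Definition coarse (R : realType) (X Y : Type) (dX : X -> X -> R)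
    (dY : Y -> Y -> R) (f : X -> Y) : Prop :=
  (forall r : R, exists s : R,
     forall x y : X, dX x y < r -> dY (f x) (f y) < s) /\
  (forall B : set Y, (diam dY B < +oo)%E -> (diam dX (f @^-1` B) < +oo)%E).

Definition coarsely_n_to_1 (R : realType) (X Y : Type) (dX : X -> X -> R)
    (dY : Y -> Y -> R) (n : nat) (f : X -> Y) : Prop :=
  coarse dX dY f /\
  forall r : R, exists s : R, forall B : set Y, (diam dY B < r%:E)%E ->
    exists C : 'I_n -> set X,
      f @^-1` B = \bigcup_(i in [set: 'I_n]) C i /\
      forall i : 'I_n, (diam dX (C i) < s%:E)%E.

Definition lipschitz_map (R : realType) (Z1 Z2 : metricType R) (g : Z1 -> Z2) :
    Prop :=
  exists K : R, forall x y : Z1, mdist (g x) (g y) <= K * mdist x y.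

(* The hyperbolic plane is the hyperboloid model in R^3; coordinate 0 is the
   timelike one. *)

Definition cosh (R : realType) (x : R) : R := (expR x + expR (- x)) / 2.
Definition sinh (R : realType) (x : R) : R := (expR x - expR (- x)) / 2.
Definition arcosh (R : realType) (x : R) : R := ln (x + Num.sqrt (x ^+ 2 - 1)).

Definition minkowski (R : realType) (u v : 'rV[R]_3) : R :=
  u 0 1 * v 0 1 + u 0 2 * v 0 2 - u 0 0 * v 0 0.

Definition hyp_plane (R : realType) : set 'rV[R]_3 :=
  [set p | minkowski p p = -1 /\ 0 < p 0 0].

Definition hyp_dist (R : realType) (p q : 'rV[R]_3) : R :=
  arcosh (- minkowski p q).

Definition unit_tangent (R : realType) (p : 'rV[R]_3) : set 'rV[R]_3 :=
  [set u | minkowski p u = 0 /\ minkowski u u = 1].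

(* The point at time t of the unit-speed geodesic from p in direction u. *)
Definition hyp_ray (R : realType) (p u : 'rV[R]_3) (t : R) : 'rV[R]_3 :=
  cosh t *: p + sinh t *: u.

Definition row3 (R : realType) (a b c : R) : 'rV[R]_3 :=
  \row_j nth 0 [:: a; b; c] j.

(* The triangle is placed with the vertex of the angle at (1, 0, 0); by
   [third_side_any] below the placement is immaterial. *)
Definition third_side (R : realType) (t t' theta : R) : R :=
  let o := row3 1 0 0 in
  hyp_dist (hyp_ray o (row3 0 1 0) t)
           (hyp_ray o (row3 0 (cos theta) (sin theta)) t').

Section hyp_plane_facts.
Variable R : realType.
Implicit Types (p q u v : 'rV[R]_3) (t theta : R).

Lemma cosh2_sinh2 t : cosh t ^+ 2 - sinh t ^+ 2 = 1.
Proof.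
rewrite /cosh /sinh expRN.
have := expR_gt0 t; move: (expR t) => a a0.
by field; rewrite gt_eqF.
Qed.

Lemma cosh0 : cosh 0 = 1 :> R.
Proof. by rewrite /cosh oppr0 expR0; field. Qed.

Lemma sinh0 : sinh 0 = 0 :> R.
Proof. by rewrite /sinh oppr0 subrr mul0r. Qed.

Lemma arcoshK t : 0 <= t -> arcosh (cosh t) = t.
Proof.
move=> t0; rewrite /arcosh.
have -> : cosh t ^+ 2 - 1 = sinh t ^+ 2 by rewrite -(cosh2_sinh2 t); ring.
have s0 : 0 <= sinh t.
  by rewrite /sinh divr_ge0// subr_ge0 ler_expR; lra.
rewrite sqrtr_sqr ger0_norm//.
have -> : cosh t + sinh t = expR t by rewrite /cosh /sinh; field.
by rewrite expRK.
Qed.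

Lemma minkowskiC u v : minkowski u v = minkowski v u.
Proof. by rewrite /minkowski; ring. Qed.

Lemma minkowski_ray p u v t t' :
  minkowski p p = -1 -> minkowski p u = 0 -> minkowski p v = 0 ->
  minkowski (hyp_ray p u t) (hyp_ray p v t') =
  sinh t * sinh t' * minkowski u v - cosh t * cosh t'.
Proof.
move=> pp pu pv.
transitivity (cosh t * cosh t' * minkowski p p + cosh t * sinh t' *
  minkowski p v + sinh t * cosh t' * minkowski p u +
  sinh t * sinh t' * minkowski u v).
  by rewrite /minkowski /hyp_ray !mxE; ring.
by rewrite pp pu pv; ring.
Qed.

Lemma hyp_dist_ray p u t : hyp_plane p -> unit_tangent p u -> 0 <= t ->
  hyp_dist p (hyp_ray p u t) = t.
Proof.
move=> [pp _] [pu uu] t0; rewrite /hyp_dist.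
have -> : minkowski p (hyp_ray p u t) =
    cosh t * minkowski p p + sinh t * minkowski p u.
  by rewrite /minkowski /hyp_ray !mxE; ring.
by rewrite pp pu mulr0 addr0 mulrN1 opprK arcoshK.
Qed.

Lemma row3_base : hyp_plane (row3 1 0 0 : 'rV[R]_3).
Proof. by rewrite /hyp_plane /minkowski /= !mxE /=; split; [ring|]. Qed.

Lemma row3_tangent theta :
  unit_tangent (row3 1 0 0) (row3 0 (cos theta) (sin theta)).
Proof.
rewrite /unit_tangent /minkowski /= !mxE /=; split; first ring.
by rewrite -(cos2Dsin2 theta); ring.
Qed.

Lemma third_sideE t t' theta :
  third_side t t' theta =
  arcosh (cosh t * cosh t' - sinh t * sinh t' * cos theta).
Proof.
have [oo _] := row3_base.
have [e1 _] := row3_tangent 0; rewrite cos0 sin0 in e1.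
have [e2 _] := row3_tangent theta.
rewrite /third_side /hyp_dist minkowski_ray// opprB; congr (arcosh (_ - _ * _)).
by rewrite /minkowski !mxE /=; ring.
Qed.

(* cos theta = <u, v> says that theta is the angle between u and v. *)
Lemma third_side_any p u v t t' theta :
  hyp_plane p -> unit_tangent p u -> unit_tangent p v ->
  minkowski u v = cos theta ->
  hyp_dist (hyp_ray p u t) (hyp_ray p v t') = third_side t t' theta.
Proof.
move=> [pp _] [pu _] [pv _] uv.
by rewrite third_sideE /hyp_dist minkowski_ray// opprB uv.
Qed.

End hyp_plane_facts.

Section cone.
Variables (R : realType) (Z : metricType R).

Definition cone_equiv (x y : Z * {nonneg R}) : bool :=
  (x == y) || ((x.2%:num == 0) && (y.2%:num == 0)).

Lemma cone_equiv_refl : reflexive cone_equiv.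
Proof. by move=> x; rewrite /cone_equiv eqxx. Qed.

Lemma cone_equiv_sym : symmetric cone_equiv.
Proof. by move=> x y; rewrite /cone_equiv eq_sym andbC. Qed.

Lemma cone_equiv_trans : transitive cone_equiv.
Proof.
move=> y x z /orP[/eqP->//|/andP[x0 y0]] /orP[/eqP<-|/andP[_ z0]];
  by rewrite /cone_equiv x0 ?y0 ?z0 orbT.
Qed.

Canonical cone_equiv_equiv :=
  EquivRel cone_equiv cone_equiv_refl cone_equiv_sym cone_equiv_trans.

Definition cone : Type := {eq_quot cone_equiv}.
HB.instance Definition _ : EqQuotient _ cone_equiv cone := EqQuotient.on cone.
HB.instance Definition _ := Choice.on cone.

Definition cone_scale : R :=
  if (0 < diam (@mdist R Z) [set: Z])%E
  then pi / fine (diam (@mdist R Z) [set: Z]) else 1.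

(* A metric only for bounded Z, hence no metricType instance. *)
Definition cone_dist (x y : cone) : R :=
  let: (z, t) := repr x in let: (z', t') := repr y in
  third_side t%:num t'%:num (cone_scale * mdist z z').

Lemma cone_distE (z z' : Z) (t t' : {nonneg R}) :
  cone_dist (\pi_cone (z, t)) (\pi_cone (z', t')) =
  third_side t%:num t'%:num (cone_scale * mdist z z').
Proof.
have reprP w s : let: (w', s') := repr (\pi_cone (w, s)) in
    (w', s') = (w, s) \/ s'%:num = 0 /\ s%:num = 0.
  have := reprK (\pi_cone (w, s)); case: (repr _) => w' s' /eqmodP/orP[/eqP|].
    by left.
  by case/andP=> /eqP s'0 /eqP s0; right.
rewrite /cone_dist; move: (reprP z t) (reprP z' t').
case: (repr _) => w s; case: (repr _) => w' s'.
by move=> [[-> ->]|[s0 t0]] [[-> ->]|[s'0 t'0]] //;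
  rewrite !third_sideE ?s0 ?t0 ?s'0 ?t'0 !sinh0; congr arcosh; ring.
Qed.

End cone.

(* On classes, (z, t) |-> (g z, t): see [radialE]. *)
Definition radial (R : realType) (Z1 Z2 : metricType R) (g : Z1 -> Z2)
    (x : cone Z1) : cone Z2 :=
  \pi_(cone Z2) (g (repr x).1, (repr x).2).

Lemma radialE (R : realType) (Z1 Z2 : metricType R) (g : Z1 -> Z2)
    (z : Z1) (t : {nonneg R}) :
  radial g (\pi_(cone Z1) (z, t)) = \pi_(cone Z2) (g z, t).
Proof.
rewrite /radial; have := reprK (\pi_(cone Z1) (z, t)).
case: (repr _) => w s /eqmodP/orP[/eqP[-> ->]//|/andP[s0 t0]] /=.
by apply/eqmodP; rewrite /= /cone_equiv /= s0 t0 orbT.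
Qed.

(* Main.v *)
(* In coordinates x = (z, t), x' = (z', t') the cone distance D satisfies
   cosh D = cosh (t - t') + sinh t sinh t' (1 - cos theta), where theta is the
   rescaled distance of z and z', and 1 - cos theta is comparable to theta^2 on
   [0, pi].  So, away from the base point, D is bounded exactly when |t - t'|
   and exp ((t + t') / 2) theta are.  If B has diameter less than r, the points
   of its preimage thus have heights close to some t0, and the g-images of their
   directions are within a distance of order exp (- t0); the hypothesis on g
   then covers these directions by n balls of radius of order exp (- t0), and
   the parts of the preimage over these balls have uniformly bounded
   diameter. *)
Require Import Defs.
From mathcomp Require Import all_boot all_order all_algebra.
From mathcomp Require Import all_classical all_reals all_analysis.
From mathcomp Require Import ring lra.

Set Implicit Arguments.
Unset Strict Implicit.
Unset Printing Implicit Defensive.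

Import Order.TTheory GRing.Theory Num.Theory.
Import numFieldNormedType.Exports.
Local Open Scope classical_set_scope.
Local Open Scope ring_scope.

(** * Quadratic bounds on 1 - cos *)

Section trigonometry.
Variable R : realType.
Implicit Types x : R.

Lemma sin_le_id x : 0 <= x -> sin x <= x.
Proof.
move=> x0.
have df (y : R) : is_derive y 1 (fun z : R => z - sin z) (1 - cos y).
  by apply: is_deriveB.
have := @ger0_derive1_ndecr R (fun z => z - sin z) 0 x _ _ _ 0 x.
rewrite sin0 subr0 subr_ge0; apply => // [y _|].
- by rewrite derive1E derive_val subr_ge0 cos_le1.
- apply: continuous_subspaceT => y.
  by apply/differentiable_continuous/derivable1_diffP; case: (df y).
Qed.

(** The difference of the two sides vanishes at 0 and has derivative [x * sin x], which is
    nonnegative on [0, pi]. *)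
Lemma id_mul_cos_le_sin x : 0 <= x <= pi -> x * cos x <= sin x.
Proof.
move=> /andP[x0 xpi].
pose f (z : R) := sin z - z * cos z.
have df (y : R) : is_derive y 1 f (y * sin y).
  have -> : y * sin y = cos y - (y *: - sin y + cos y *: 1).
    by rewrite /GRing.scale/=; ring.
  by apply: is_deriveB.
rewrite -subr_ge0 -/(f x).
have := @ger0_derive1_ndecr R f 0 x _ _ _ 0 x.
rewrite {4}/f sin0 mul0r subr0; apply => // [y|].
- rewrite in_itv/= derive1E derive_val => /andP[y0 yx].
  by rewrite mulr_ge0 ?(ltW y0)// sin_ge0_pi// ltW//= (le_trans (ltW yx)).
- apply: continuous_subspaceT => y.
  by apply/differentiable_continuous/derivable1_diffP; case: (df y).
Qed.

Lemma cos_half_sin x : 1 - cos x = 2 * sin (x / 2) ^+ 2.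
Proof.
have {1}-> : x = (x / 2) *+ 2 by rewrite mulr2n; field.
by rewrite cos_mulr2n cos2sin2; ring.
Qed.

Lemma cos_lower_bound x : 0 <= x -> 1 - cos x <= x ^+ 2 / 2.
Proof.
move=> x0; have y0 : 0 <= x / 2 by lra.
rewrite cos_half_sin.
have : `|sin (x / 2)| <= `|x / 2|.
  have [y1|y1] := leP (x / 2) pi.
    by rewrite !ger0_norm ?sin_le_id// sin_ge0_pi// y0.
  (* Past pi the bound 1 on the sine suffices, as pi >= 2. *)
  rewrite (le_trans (sin_max _))// ger0_norm//.
  by have := pi_ge2 R; lra.
rewrite -ler_sqr ?nnegrE// !real_normK ?num_real// => h.
by apply: (le_trans (ler_wpM2l _ h)) => //; lra.
Qed.

Lemma cos_upper_bound x : 0 <= x <= pi -> x ^+ 2 / 8 <= 1 - cos x.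
Proof.
(* With x = 4 y, 1 - cos x = 8 (cos y sin y)^2, where sin y >= y cos y and
   cos^2 y >= 1/2 because y <= pi/4. *)
have [y ->] : exists y, x = 4 * y by exists (x / 4); field.
move=> /andP[y40 ypi]; rewrite cos_half_sin.
have y0 : 0 <= y by lra.
have -> : 4 * y / 2 = y *+ 2 by rewrite mulr2n; field.
have -> : (4 * y) ^+ 2 / 8 = 2 * y ^+ 2 by field.
rewrite sin_mulr2n.
have p0 := pi_gt0 R.
have sy : y * cos y <= sin y by apply: id_mul_cos_le_sin; lra.
have c2 : 1 / 2 <= cos y ^+ 2.
  have := cos_mulr2n y.
  have : 0 <= cos (y *+ 2) by apply: cos_ge0_pihalf; rewrite -mulr_natl; lra.
  lra.
have c0 : 0 <= cos y by apply: cos_ge0_pihalf; lra.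
have h : y / 2 <= cos y * sin y.
  apply: (@le_trans _ _ (cos y * (y * cos y))); last exact: ler_wpM2l.
  have -> : cos y * (y * cos y) = y * cos y ^+ 2 by ring.
  by apply: (le_trans _ (ler_wpM2l y0 c2)); lra.
have h2 : (y / 2) ^+ 2 <= (cos y * sin y) ^+ 2.
  by rewrite ler_sqr ?nnegrE//; lra.
have -> : 2 * (cos y * sin y *+ 2) ^+ 2 = 8 * (cos y * sin y) ^+ 2 by ring.
have -> : 2 * y ^+ 2 = 8 * (y / 2) ^+ 2 by field.
by lra.
Qed.

End trigonometry.

(** * Estimates of the third side of a hyperbolic triangle *)

Section hyperbolic.
Variable R : realType.
Implicit Types t c th : R.

Lemma le_arcosh c c' : 1 <= c -> c <= c' -> arcosh c <= arcosh c'.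
Proof.
move=> c1 cc'; rewrite /arcosh.
have s0 := sqrtr_ge0 (c ^+ 2 - 1).
rewrite ler_ln ?posrE ?(lt_le_trans _ (lerD c1 s0)) ?addr0//.
  by rewrite lerD// ler_wsqrtr// lerB// ler_sqr ?nnegrE; lra.
by have := sqrtr_ge0 (c' ^+ 2 - 1); lra.
Qed.

Lemma le_expR_arcosh c : 1 <= c -> c <= expR (arcosh c).
Proof.
have s0 := sqrtr_ge0 (c ^+ 2 - 1).
by move=> c1; rewrite /arcosh lnK ?posrE; lra.
Qed.

Lemma sinh_ge0 t : 0 <= t -> 0 <= sinh t.
Proof.
by move=> t0; rewrite /sinh divr_ge0// subr_ge0 ler_expR; lra.
Qed.

Lemma sinh_le_expR t : sinh t <= expR t / 2.
Proof. by rewrite /sinh; have := expR_gt0 (- t); lra. Qed.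

(** From [expR (2 * t) >= 1 + 2 * t >= 3], the term [expR (- t)] is less than half of [expR t]. *)
Lemma sinh_ge_expR t : 1 <= t -> expR t / 4 <= sinh t.
Proof.
move=> t1; rewrite /sinh.
have -> : expR t = expR (t *+ 2) * expR (- t).
  by rewrite -expRD; congr expR; ring.
have := expR_ge1Dx (t *+ 2); have := expR_gt0 (- t).
rewrite mulr2n; move: (expR _) (expR _) => u v; nra.
Qed.

Lemma cosh_ge1 t : 1 <= cosh t.
Proof.
rewrite /cosh expRN; have := expR_gt0 t; move: (expR t) => u u0.
rewrite -subr_ge0.
have -> : (u + u^-1) / 2 - 1 = (u - 1) ^+ 2 / (2 * u) by field; lra.
by rewrite divr_ge0 ?sqr_ge0//; lra.
Qed.

Lemma cosh_le_expR t : cosh t <= expR `|t|.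
Proof.
have h : expR t <= expR `|t| by rewrite ler_expR ler_norm.
have h' : expR (- t) <= expR `|t| by rewrite ler_expR -normrN ler_norm.
by rewrite /cosh; lra.
Qed.

Lemma expR_le_cosh t : expR `|t| / 2 <= cosh t.
Proof.
rewrite /cosh; have := expR_gt0 t; have := expR_gt0 (- t).
by case: (ger0P t) => _; lra.
Qed.

(** The hyperbolic cosine of the third side, by the hyperbolic law of cosines. *)
Definition hyp_law (t t' th : R) : R :=
  cosh t * cosh t' - sinh t * sinh t' * cos th.

Lemma hyp_lawE t t' th :
  hyp_law t t' th = cosh (t - t') + sinh t * sinh t' * (1 - cos th).
Proof.
rewrite /hyp_law /cosh /sinh opprB !expRB !expRN.
have := expR_gt0 t; have := expR_gt0 t'; move: (expR t) (expR t') => u v u0 v0.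
by field; lra.
Qed.

Variables t t' th : R.
Hypotheses (t0 : 0 <= t) (t'0 : 0 <= t').

Let sinhM_ge0 : 0 <= sinh t * sinh t'.
Proof. by apply: mulr_ge0; exact: sinh_ge0. Qed.

Lemma cosh_le_hyp_law : cosh (t - t') <= hyp_law t t' th.
Proof.
by rewrite hyp_lawE lerDl mulr_ge0 ?sinhM_ge0// subr_ge0 cos_le1.
Qed.

Lemma hyp_law_ge1 : 1 <= hyp_law t t' th.
Proof. exact: le_trans (cosh_ge1 _) cosh_le_hyp_law. Qed.

Lemma hyp_law_le_expR_third_side :
  hyp_law t t' th <= expR (third_side t t' th).
Proof. by rewrite third_sideE; apply: le_expR_arcosh hyp_law_ge1. Qed.

Lemma third_side_le_arcosh c :
  hyp_law t t' th <= c -> third_side t t' th <= arcosh c.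
Proof.
move=> lc; rewrite third_sideE; exact: le_arcosh hyp_law_ge1 lc.
Qed.

(** The summand 1 absorbs the factor 1/2 of [expR_le_cosh], since e >= 2. *)
Lemma dist_height_le_third_side : `|t - t'| <= third_side t t' th + 1.
Proof.
rewrite -ler_expR expRD.
have := expR_le_cosh (t - t'); have := cosh_le_hyp_law.
have := hyp_law_le_expR_third_side; have := expR_ge1Dx (1 : R).
have := expR_gt0 (third_side t t' th).
move: (expR (third_side _ _ _)) (expR `|_|) (expR 1) (cosh _) => a b c d.
by nra.
Qed.

Lemma hyp_law_le_height (T : R) :
  t <= T -> t' <= T -> hyp_law t t' th <= expR T ^+ 2 *+ 2.
Proof.
move=> tT t'T.
have hc u : 0 <= u -> u <= T -> cosh u <= expR T.
  move=> u0 uT; apply: le_trans (cosh_le_expR _) _.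
  by rewrite ger0_norm// ler_expR.
have hs u : 0 <= u -> u <= T -> sinh u <= expR T.
  move=> u0 uT; apply: le_trans (sinh_le_expR _) _.
  have : expR u <= expR T by rewrite ler_expR.
  by have := expR_gt0 u; lra.
rewrite /hyp_law mulr2n lerD//.
  by rewrite expr2 ler_pM ?hc// (le_trans _ (cosh_ge1 _)).
rewrite -mulrN; apply: (@le_trans _ _ (sinh t * sinh t' * 1)).
  by rewrite ler_wpM2l ?sinhM_ge0// lerNl cos_geN1.
by rewrite mulr1 expr2 ler_pM ?sinh_ge0 ?hs.
Qed.

Lemma hyp_law_le_angle : 0 <= th ->
  hyp_law t t' th <= expR `|t - t'| + (expR t * expR t') * th ^+ 2 / 8.
Proof.
move=> th0; rewrite hyp_lawE lerD ?cosh_le_expR//.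
apply: (@le_trans _ _ (expR t / 2 * (expR t' / 2) * (th ^+ 2 / 2))); last lra.
apply: ler_pM; rewrite ?sinhM_ge0 ?subr_ge0 ?cos_le1//.
  by apply: ler_pM; rewrite ?sinh_ge0 ?sinh_le_expR.
exact: cos_lower_bound.
Qed.

(** Heights at least 1 allow [sinh_ge_expR]; the constant is 128 = 4 * 4 * 8, with 8 from
    [cos_upper_bound]. *)
Lemma angle_le_hyp_law : 1 <= t -> 1 <= t' -> 0 <= th <= pi ->
  (expR t * expR t') * th ^+ 2 / 128 <= hyp_law t t' th.
Proof.
move=> t1 t'1 thpi; rewrite hyp_lawE.
have h : expR t / 4 * (expR t' / 4) * (th ^+ 2 / 8) <=
    sinh t * sinh t' * (1 - cos th).
  have e0 u : 0 <= expR u / 4 :> R by rewrite divr_ge0 ?expR_ge0.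
  apply: ler_pM (cos_upper_bound thpi); first exact: mulr_ge0.
    by rewrite divr_ge0 ?sqr_ge0.
  by apply: ler_pM; rewrite ?e0 ?sinh_ge_expR.
by have := cosh_ge1 (t - t'); lra.
Qed.

(** The two quadratic bounds give 1 - cos at most a factor 8 k^2 / 2 = 4 k^2, and the term
    [cosh (t - t')] does not change. A bounded factor on the cosine of the distance keeps bounded
    distances bounded. *)
Lemma hyp_law_le_mul (th' k : R) : 0 <= th <= pi -> 0 <= th' -> th' <= k * th ->
  hyp_law t t' th' <= (1 + 4 * k ^+ 2) * hyp_law t t' th.
Proof.
move=> thpi th'0 th'k; rewrite !hyp_lawE.
have h : 1 - cos th' <= 4 * k ^+ 2 * (1 - cos th).
  apply: (le_trans (cos_lower_bound th'0)).
  have : th' ^+ 2 <= (k * th) ^+ 2.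
    by rewrite ler_sqr ?nnegrE// (le_trans th'0).
  have := ler_wpM2l (sqr_ge0 k) (cos_upper_bound thpi).
  by rewrite exprMn; lra.
have := ler_wpM2l sinhM_ge0 h; have := cosh_ge1 (t - t').
have := mulr_ge0 sinhM_ge0 (_ : 0 <= 1 - cos th).
rewrite subr_ge0 cos_le1 => /(_ isT).
by have := sqr_ge0 k; nra.
Qed.

End hyperbolic.

(** * Diameters in the extended reals *)

Section diameter.
Variables (R : realType) (X : Type) (d : X -> X -> R).
Implicit Types (B : set X) (s : R).

Lemma diam_le B s : (forall x y, B x -> B y -> d x y <= s) ->
  (diam d B <= s%:E)%E.
Proof.
move=> dB; apply: ge_ereal_sup => _ [x Bx [y By <-]].
by rewrite lee_fin dB.
Qed.

Lemma le_diam B x y : B x -> B y -> ((d x y)%:E <= diam d B)%E.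
Proof. by move=> Bx By; apply: ereal_sup_ubound; exists x => //; exists y. Qed.

Lemma diam_lty B : (diam d B < +oo)%E ->
  exists s, forall x y, B x -> B y -> d x y <= s.
Proof.
have := @le_diam B; case: (diam d B) => [s| |] Bs // _.
  by exists s => x y Bx By; rewrite -lee_fin Bs.
(* Diameter -oo: [le_diam] excludes any point of [B]. *)
by exists 0 => x y Bx /(Bs x y Bx).
Qed.

End diameter.

(** * Boundedness and angles over a compact metric space *)

Section compact_metric.
Variables (R : realType) (Z : metricType R).

Lemma continuous_mdist (a : Z) : continuous (mdist a).
Proof.
move=> x; apply/cvgrPdist_lt => e e0.
apply: filterS (nbhsx_ballx x e e0) => y; rewrite ballEmdist/= => xy.
rewrite ltr_norml; have := metric_triangle a x y; have := metric_triangle a y x.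
by rewrite (metric_sym y x); lra.
Qed.

Hypothesis cZ : compact [set: Z].

Lemma mdist_bounded : exists M : R, forall x y : Z, mdist x y <= M.
Proof.
have [[a _]|Z0] := pselect ([set: Z] !=set0); last first.
  by exists 0 => x; case: Z0; exists x.
have : compact (mdist a @` [set: Z]).
  exact/continuous_compact/cZ/continuous_subspaceT/continuous_mdist.
move=> /compact_bounded[M [_ MB]].
exists ((M + 1) *+ 2) => x y.
apply: le_trans (metric_triangle x a y) _; rewrite mulr2n.
have ub z : mdist a z <= M + 1.
  apply: le_trans (ler_norm _) _.
  by apply: (MB (M + 1)); rewrite ?ltrDl//; exists z.
by rewrite lerD// metric_sym.
Qed.

Lemma cone_scale_gt0 : 0 < cone_scale Z.
Proof.
have [M Mb] := mdist_bounded.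
rewrite /cone_scale; case: ifPn => // d0.
(* Finiteness of the diameter matters: [fine] sends +oo to 0, which would make the scale 0. *)
rewrite divr_gt0 ?pi_gt0 ?fine_gt0// d0/=.
by apply: le_lt_trans (ltry M); apply: diam_le => x y _ _.
Qed.

(** The scale pi / diam is made for this: [cos_upper_bound] needs angles in [0, pi]. In the branch
    with scale 1 all distances are 0. *)
Lemma cone_angle_itv (x y : Z) : 0 <= cone_scale Z * mdist x y <= pi.
Proof.
rewrite mulr_ge0 ?(ltW cone_scale_gt0) ?mdist_ge0//=.
have [M Mb] := mdist_bounded.
have xyD := @le_diam R Z (@mdist R Z) [set: Z] x y Logic.I Logic.I.
rewrite /cone_scale; case: ifPn => [d0|]; last first.
  rewrite -leNgt => /(le_trans xyD); rewrite lee_fin => xy0.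
  by rewrite mul1r (le_trans xy0)// pi_ge0.
have dfin : diam (@mdist R Z) [set: Z] \is a fin_num.
  rewrite ge0_fin_numE ?(ltW d0)//.
  by apply: le_lt_trans (ltry M); apply: diam_le => *.
move: d0 xyD; rewrite -(fineK dfin) lte_fin lee_fin /= => d0 xyD.
by rewrite -mulrA ler_piMr ?pi_ge0// ler_pdivrMl// mulr1.
Qed.

End compact_metric.

(** * Finite nets from maximal separated sequences *)

Lemma separated_cover (R : realType) (Z : metricType R) (P : set Z) (r : R)
    (n : nat) (z0 : Z) :
  (forall x : 'I_n.+1 -> Z, (forall i, P (x i)) ->
     exists k m : 'I_n.+1, k != m /\ mdist (x k) (x m) <= r) ->
  exists w : 'I_n -> Z, forall z, P z -> exists i, mdist z (w i) <= r.
Proof.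
(* A maximal r-separated sequence in P has at most n terms and is r-dense. *)
move=> sep.
pose far (x y : Z) := r < mdist x y.
pose ok k := `[< exists s : seq Z,
  [/\ size s = k, forall z, z \in s -> P z & pairwise far s] >].
have ok_le k : ok k -> (k <= n)%N.
  move=> /asboolP[s [sk sP /(pairwiseP z0) sfar]]; rewrite leqNgt; apply/negP.
  move=> nk; have nth_lt (i : 'I_n.+1) : (i < size s)%N.
    by rewrite sk (leq_trans (ltn_ord i)).
  have [i|k1 [m1 [km]]] := sep (fun i : 'I_n.+1 => nth z0 s i).
    by apply/sP/mem_nth.
  rewrite leNgt => /negP; apply; move: km.
  rewrite -val_eqE neq_ltn => /orP[] h; last rewrite metric_sym;
    by apply: (sfar _ _ _ _ h); exact: nth_lt.
have ok0 : exists k, ok k by exists 0%N; apply/asboolP; exists [::].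
case: (ex_maxnP ok0 ok_le) => k okk kmax.
move/asboolP: (okk) => [s [sk sP sfar]].
(* If [s] has fewer than [n] terms, the default [z0] fills the remaining centres. *)
exists (fun i => nth z0 s i) => z Pz.
have [/hasP[y ys zy]|/hasPn h] := boolP (has (fun y => mdist z y <= r) s).
  have iy : (index y s < n)%N.
    by rewrite (leq_trans _ (ok_le _ okk))// -sk index_mem.
  by exists (Ordinal iy); rewrite /= nth_index.
suff /kmax : ok k.+1 by rewrite ltnn.
apply/asboolP; exists (z :: s); split; first by rewrite /= sk.
  by move=> y; rewrite inE => /predU1P[->//|/sP].
by rewrite /= sfar andbT; apply/allP => y /h; rewrite /far ltNge.
Qed.

(** * Coordinates on the cone *)

Section cone_coordinates.
Variables (R : realType) (Z : metricType R).

Definition height (x : cone Z) : R := (repr x).2%:num.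
(** At the apex this is an arbitrary point; there [sinh] of the height is 0, so the angle drops out
    of the distance. *)
Definition direction (x : cone Z) : Z := (repr x).1.

Lemma height_ge0 x : 0 <= height x. Proof. by rewrite /height. Qed.

Lemma cone_dist_coord x y : cone_dist x y =
  third_side (height x) (height y)
    (cone_scale Z * mdist (direction x) (direction y)).
Proof.
rewrite /cone_dist /height /direction.
by case: (repr x) => z t; case: (repr y) => z' t'.
Qed.

End cone_coordinates.

Lemma cone_dist_radial (R : realType) (Z1 Z2 : metricType R) (g : Z1 -> Z2)
    (x y : cone Z1) : cone_dist (radial g x) (radial g y) =
  third_side (height x) (height y)
    (cone_scale Z2 * mdist (g (direction x)) (g (direction y))).
Proof. exact: cone_distE. Qed.

(** * Coarseness of the radial map and closeness of image directions *)

Section radial_map.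
Variables (R : realType) (Z1 Z2 : metricType R) (g : Z1 -> Z2).
Hypotheses (cZ1 : compact [set: Z1]) (cZ2 : compact [set: Z2]).

Local Notation angle Z x y :=
  (cone_scale Z * mdist (direction x) (direction y)).

Lemma cone_dist_le_height (T : R) (x y : cone Z1) :
  height x <= T -> height y <= T ->
  cone_dist x y <= arcosh (expR T ^+ 2 *+ 2).
Proof.
move=> xT yT; rewrite cone_dist_coord.
apply: third_side_le_arcosh; rewrite ?height_ge0//.
by rewrite hyp_law_le_height ?height_ge0.
Qed.

Lemma dist_height_le_radial (x y : cone Z1) :
  `|height x - height y| <= cone_dist (radial g x) (radial g y) + 1.
Proof. by rewrite cone_dist_radial dist_height_le_third_side ?height_ge0. Qed.

(** A Lipschitz map multiplies angles by a bounded factor, which [hyp_law_le_mul] turns into control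
    of distances. Preimages of bounded sets are bounded because heights are preserved. *)
Lemma radial_coarse : lipschitz_map g ->
  coarse (@cone_dist R Z1) (@cone_dist R Z2) (radial g).
Proof.
move=> [K gK]; split=> [r|B /diam_lty[s Bs]].
  (* A Lipschitz constant of [g] for the rescaled metrics, that is, for angles. *)
  pose k := cone_scale Z2 * K / cone_scale Z1.
  exists (arcosh ((1 + 4 * k ^+ 2) * expR r) + 1) => x y xyr.
  rewrite ltr_pwDr// cone_dist_radial.
  have th2 := cone_angle_itv cZ2 (g (direction x)) (g (direction y)).
  apply: third_side_le_arcosh; rewrite ?height_ge0//.
  apply: le_trans (hyp_law_le_mul (height_ge0 x) (height_ge0 y)
    (cone_angle_itv cZ1 (direction x) (direction y)) _ (_ : _ <= k * _)) _.
    by case/andP: th2.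
    have m1 := cone_scale_gt0 cZ1; have m2 := cone_scale_gt0 cZ2.
    by rewrite /k mulrA divfK ?gt_eqF// -mulrA ler_wpM2l// ltW.
  apply: ler_wpM2l; first by have := sqr_ge0 k; lra.
  apply: le_trans (hyp_law_le_expR_third_side _ _ _) _; rewrite ?height_ge0//.
  by rewrite ler_expR -cone_dist_coord ltW.
have [[x0 Bx0]|B0] := pselect (exists x, B (radial g x)); last first.
  apply: le_lt_trans (ltry 0); apply: diam_le => x y Bx.
  by case: B0; exists x.
apply: le_lt_trans (ltry _); apply: diam_le => x y Bx By.
suff hT z : B (radial g z) -> height z <= height x0 + s + 1.
  by apply: cone_dist_le_height; apply: hT.
move=> Bz; have := dist_height_le_radial z x0; have := Bs _ _ Bz Bx0.
by have := ler_norm (height z - height x0); lra.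
Qed.

(** By [angle_le_hyp_law] the angle th of the images satisfies
    [expR h ^+ 2 * th ^+ 2 <= 128 * expR r]; on taking roots, 16 rounds up the square root of
    128. *)
Lemma mdist_le_expR (r h : R) (x y : cone Z1) :
  1 <= height x -> 1 <= height y -> h <= height x -> h <= height y ->
  cone_dist (radial g x) (radial g y) <= r ->
  mdist (g (direction x)) (g (direction y)) <=
    16 * expR (r / 2 - h) / cone_scale Z2.
Proof.
move=> x1 y1 hx hy xyr.
have m2 := cone_scale_gt0 cZ2.
have th2 := cone_angle_itv cZ2 (g (direction x)) (g (direction y)).
rewrite ler_pdivlMr// mulrC.
have := angle_le_hyp_law x1 y1 th2.
have := hyp_law_le_expR_third_side
  (cone_scale Z2 * mdist (g (direction x)) (g (direction y)))
  (height_ge0 x) (height_ge0 y).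
rewrite -cone_dist_radial.
have : expR (cone_dist (radial g x) (radial g y)) <= expR r by rewrite ler_expR.
have : expR h * expR h <= expR (height x) * expR (height y).
  by apply: ler_pM; rewrite ?expR_ge0 ?ler_expR.
case/andP: th2; move: (cone_scale Z2 * _) => th th0 _.
(* In this form the factor [expR h * expR h] cancels. *)
have -> : expR r = expR (r / 2 - h) ^+ 2 * (expR h * expR h).
  by rewrite expr2 -!expRD; congr expR; field.
have H0 : 0 < expR h * expR h by rewrite mulr_gt0 ?expR_gt0.
have E0 : 0 < expR (r / 2 - h) by exact: expR_gt0.
move: (expR (r / 2 - h)) (expR h * expR h) (expR (height x) * _) E0 H0.
move=> E H XY E0 H0 HXY h1 h2 h3.
have h4 : H * th ^+ 2 <= XY * th ^+ 2 by rewrite ler_wpM2r ?sqr_ge0.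
have h5 : H * th ^+ 2 <= H * (128 * E ^+ 2) by lra.
rewrite ler_pM2l// in h5.
rewrite -ler_sqr ?nnegrE//; last by lra.
by have := sqr_ge0 E; rewrite exprMn; lra.
Qed.

End radial_map.

(** * Splitting the preimage of a set of bounded diameter *)

Theorem theorem9p3 (R : realType) (Z1 Z2 : metricType R) (g : Z1 -> Z2)
    (n : nat)
    (cZ1 : compact [set: Z1]) (cZ2 : compact [set: Z2])
    (glip : lipschitz_map g) (n_ge1 : (1 <= n)%N)
    (gsep : exists A : R, 0 < A /\
      forall (r : R) (x : 'I_n.+1 -> Z1), 0 < r ->
        (forall i j : 'I_n.+1, i != j -> r < mdist (x i) (x j)) ->
        exists k m : 'I_n.+1, k != m /\ A * r <= mdist (g (x k)) (g (x m))) :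
  coarsely_n_to_1 (@cone_dist R Z1) (@cone_dist R Z2) n (radial g).
Proof.
split; first exact: radial_coarse.
have [A [A0 sepA]] := gsep => r.
(* [rho] bounds how far heights in the preimage of [B] stray from a chosen one, [height x0];
   [M * expR (- height x0)] is the bound of [mdist_le_expR] at [h = height x0 - rho]. *)
pose rho := r + 1; pose M := 16 * expR (r / 2 + rho) / cone_scale Z2.
have m1 := cone_scale_gt0 cZ1; have m2 := cone_scale_gt0 cZ2.
have M0 : 0 < M by rewrite divr_gt0// mulr_gt0// expR_gt0.
(* [L * expR (- height x0)] will bound the angle between directions within [delta] of a common
   centre. *)
pose L := cone_scale Z1 * (2 * M / A + 2 * M / A).
(* [c1] serves preimages near the base point, [c2] the pieces far from it; neither depends on
   [B]. *)
pose c1 := arcosh (expR (2 * rho + 1) ^+ 2 *+ 2).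
pose c2 := arcosh (expR (rho + rho) + expR (rho + rho) * L ^+ 2 / 8).
exists (Num.max c1 c2 + 1) => B Br.
have dB x y : B x -> B y -> cone_dist x y < r.
  by move=> Bx By; rewrite -lte_fin; exact: le_lt_trans (le_diam _ Bx By) Br.
suff [C BC Cs] : exists2 C : 'I_n -> set (cone Z1),
    radial g @^-1` B = \bigcup_(i in [set: 'I_n]) C i &
    forall i x y, C i x -> C i y -> cone_dist x y <= Num.max c1 c2.
  exists C; split=> // i; apply: (@le_lt_trans _ _ (Num.max c1 c2)%:E).
    exact/diam_le/Cs.
  by rewrite lte_fin ltrDl.
have [[x0 Bx0]|B0] := pselect (exists x, B (radial g x)); last first.
  exists (fun=> set0) => //; rewrite bigcup0//.
  by apply/seteqP; split=> // x Bx; case: B0; exists x.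
have height_near x : B (radial g x) ->
    height x0 - rho <= height x /\ height x <= height x0 + rho.
  move=> Bx; have := dist_height_le_radial g x x0; have := dB _ _ Bx Bx0.
  have := ler_norm (height x - height x0).
  have := ler_norm (height x0 - height x).
  by rewrite (distrC (height x0)) /rho; split; lra.
(* Low preimages are bounded outright. Above the threshold all heights exceed 1, as [mdist_le_expR]
   requires. *)
have [small|large] := leP (height x0) (rho + 1).
  (* Every piece is the whole preimage; [n_ge1] supplies an index for the union. *)
  exists (fun=> radial g @^-1` B) => [|_ x y Bx By].
    by rewrite bigcup_const//; exists (Ordinal n_ge1).
  rewrite le_max; apply/orP; left.
  by apply: cone_dist_le_height; have [] := height_near _ Bx;
    have [] := height_near _ By; lra.
pose e0 := expR (- height x0).
have e0_gt0 : 0 < e0 by exact: expR_gt0.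
(* The images of the directions in the preimage of B are M e0-close, while
   A delta = 2 M e0: hence no n+1 of these directions are delta-separated. *)
pose delta := 2 * M / A * e0.
have delta0 : 0 < delta by rewrite mulr_gt0// divr_gt0// mulr_gt0.
have [|w wP] := @separated_cover R Z1
    (@direction R Z1 @` (radial g @^-1` B)) delta n (direction x0).
  move=> x xP; apply: contrapT => x_sep.
  have x_far i j : i != j -> delta < mdist (x i) (x j).
    move=> ij; rewrite ltNge; apply/negP => le_ij.
    by apply: x_sep; exists i, j.
  have [k [m [_]]] := sepA delta x delta0 x_far.
  have [y By <-] := xP k; have [z Bz <-] := xP m.
  have [[ylo _] [zlo _]] := (height_near _ By, height_near _ Bz).
  have -> : A * delta = 2 * (M * e0) by rewrite /delta; field; rewrite gt_eqF.
  have := @mdist_le_expR _ _ _ g cZ2 r (height x0 - rho) y z.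
  have -> : 16 * expR (r / 2 - (height x0 - rho)) / cone_scale Z2 = M * e0.
    by rewrite /M /e0 opprB addrA expRD; ring.
  have Me0 : 0 < M * e0 by exact: mulr_gt0.
  by move=> /(_ _ _ ylo zlo (ltW (dB _ _ By Bz))); lra.
exists (fun i => radial g @^-1` B `&`
    [set x | mdist (direction x) (w i) <= delta]).
  apply/seteqP; split=> [x Bx|x [i _ []//]].
  by have [|i xi] := wP (direction x); [exists x|exists i].
move=> i x y [Bx xw] [By yw]; rewrite le_max; apply/orP; right.
rewrite cone_dist_coord; apply: third_side_le_arcosh; rewrite ?height_ge0//.
apply: le_trans (hyp_law_le_angle (height_ge0 x) (height_ge0 y) _) _.
  by case/andP: (cone_angle_itv cZ1 (direction x) (direction y)).
have [[xlo xhi] [ylo yhi]] := (height_near _ Bx, height_near _ By).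
rewrite lerD//.
  by rewrite ler_expR ler_norml; apply/andP; split; lra.
(* Each direction is within [delta] of the centre [w i], whence the two equal summands of [L]. *)
have th_le : cone_scale Z1 * mdist (direction x) (direction y) <= L * e0.
  rewrite /L -mulrA ler_wpM2l ?(ltW m1)// mulrDl.
  apply: le_trans (metric_triangle _ (w i) _) _.
  by rewrite lerD// metric_sym.
rewrite ler_pM2r//.
(* The factor [e0 ^+ 2] cancels the growth in [height x0], leaving [expR (rho + rho)], which is the
   same for all [B]. *)
apply: (@le_trans _ _
    (expR (height x0 + rho) * expR (height x0 + rho) * (L * e0) ^+ 2)).
  apply: ler_pM; [by rewrite mulr_ge0 ?expR_ge0|exact: sqr_ge0| |].
    by apply: ler_pM; rewrite ?expR_ge0 ?ler_expR.
  have /andP[th0 _] := cone_angle_itv cZ1 (direction x) (direction y).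
  by rewrite ler_sqr ?nnegrE// (le_trans th0).
have -> : expR (rho + rho) =
    expR (height x0 + rho) * expR (height x0 + rho) * e0 ^+ 2.
  by rewrite /e0 expr2 -!expRD; congr expR; ring.
by rewrite le_eqVlt; apply/orP; left; apply/eqP; ring.
Qed.
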